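(* Let $V$ be a real vector space with $\dim V=3$ and let $\{e_1,e_2,e_3\}$ be a basis of $V$. Identify $V\cong\mathbb{R}^3$ via this basis, let $\mathrm{SO}(2)\subset\mathrm{O}(3)$ be the subgroup of rotations with axis $e_3$, and consider the induced action on $W^*$. Let $M\in(W^* )^{\mathrm{SO}(2)}$ be an invariant element. Then $M\in\mathcal{C}_W^*$ if and only if $M$ satisfies the elastic bounds, i.e. $M(\alpha\otimes\beta,\alpha\otimes\beta)\ge0$ for all $\alpha,\beta\in V^*$.
   Context: $W:=\{S\in \mathrm{Sym}^2(\mathrm{Sym}^2V^* )\oplus\mathrm{Sym}^2(\Lambda^2V^* ):\tau S=S\}\subset (V^* )^{\otimes 4}$, where $(\tau S)(v_1,v_2,v_3,v_4)=S(v_1,v_4,v_3,v_2)$. Each $S\in W$ is regarded as a symmetric bilinear form on $V\otimes V$ via $S(a\otimes b,c\otimes d)=S(a,b,c,d)$, and $\mathcal{C}_W:=\{S\in W:S\ge0\}$ is the cone of positive semi-definite elements. The dual space $W^*$ is identified, via the natural pairing of $V^{\otimes 4}$ with $(V^* )^{\otimes 4}$, with the space of tensors $M\in V^{\otimes 4}$ having the same symmetries, i.e. $M\in\mathrm{Sym}^2(\mathrm{Sym}^2V)\oplus\mathrm{Sym}^2(\Lambda^2V)$ and $M$ is invariant under exchanging its second and fourth tensor factors. Such an $M$ is also viewed as a symmetric bilinear form on $V^*\otimes V^*$. The dual cone is $\mathcal{C}_W^*:=\{M\in W^*: M(S)\ge0\ \text{for all } S\in\mathcal{C}_W\}$, where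 $M(S)$ is the natural pairing. For a group $G$ acting on $W^*$, $(W^* )^G$ denotes the subspace of $G$-invariant elements. *)

(* Defs.v *)
From HB Require Import structures.
From mathcomp Require Import all_boot all_order all_algebra.
From mathcomp Require Import reals.

Set Implicit Arguments.
Unset Strict Implicit.
Unset Printing Implicit Defensive.
Import Order.TTheory GRing.Theory Num.Theory.
Local Open Scope ring_scope.

(* A tensor in (U^* )^{(x)4} is a 4-linear form on U.  The definitions below are
   used with U = V for (V^* )^{(x)4}, and with U = V^* for V^{(x)4}, where V is
   identified with V^** since it is finite-dimensional. *)
Definition form4 (R : realType) (U : lmodType R) := U -> U -> U -> U -> R.

Section Symmetries.
Variables (R : realType) (U : lmodType R).
Implicit Types S T : form4 U.

Definition multilinear4 S : Prop :=
  [/\ forall b c d, scalar (fun a => S a b c d),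
      forall a c d, scalar (fun b => S a b c d),
      forall a b d, scalar (fun c => S a b c d)
    & forall a b c, scalar (fun d => S a b c d)].

(* Sym^2(Sym^2 U^* ) *)
Definition sym2_sym2 S : Prop :=
  [/\ multilinear4 S,
      forall a b c d, S b a c d = S a b c d,
      forall a b c d, S a b d c = S a b c d
    & forall a b c d, S c d a b = S a b c d].

(* Sym^2(Lambda^2 U^* ) *)
Definition sym2_alt2 S : Prop :=
  [/\ multilinear4 S,
      forall a b c d, S b a c d = - S a b c d,
      forall a b c d, S a b d c = - S a b c d
    & forall a b c d, S c d a b = S a b c d].

Definition tau S : form4 U := fun v1 v2 v3 v4 => S v1 v4 v3 v2.

Definition in_W S : Prop :=
  (exists S1 S2, [/\ sym2_sym2 S1, sym2_alt2 S2 &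
     forall a b c d, S a b c d = S1 a b c d + S2 a b c d])
  /\ (forall a b c d, tau S a b c d = S a b c d).

(* S(X, X) >= 0 for every X in U (x) U; such an X is a finite sum of pure
   tensors a k (x) b k. *)
Definition psd S : Prop :=
  forall (n : nat) (a b : 'I_n -> U),
    0 <= \sum_(k < n) \sum_(l < n) S (a k) (b k) (a l) (b l).

Definition in_cone S : Prop := in_W S /\ psd S.

End Symmetries.

Section Dual.
Variables (R : realType) (V : vectType R).

Definition dual := 'Hom(V, R^o).

Implicit Types (e : 3.-tuple V) (S : form4 V) (M : form4 dual) (g : 'End(V)).

Definition dual_basis e (i : 'I_3) : dual := linfun (coord e i : V -> R^o).

(* The natural pairing of V^{(x)4} with (V^* )^{(x)4}, computed in e; see
   pairing_pure. *)
Definition pairing e M S : R :=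
  \sum_(i < 3) \sum_(j < 3) \sum_(k < 3) \sum_(l < 3)
    M (dual_basis e i) (dual_basis e j) (dual_basis e k) (dual_basis e l)
    * S e`_i e`_j e`_k e`_l.

Definition pure4 (a b c d : V) : form4 dual :=
  fun x y z t => x a * y b * z c * t d.

Lemma pairing_pure e S a b c d : basis_of {:V} e -> multilinear4 S ->
  pairing e (pure4 a b c d) S = S a b c d.
Proof.
move=> he [l1 l2 l3 l4].
have ex (f : V -> R) v : scalar f -> f v = \sum_(i < 3) coord e i v * f e`_i.
  move=> fl; pose F : {scalar V} :=
    HB.pack f (GRing.isLinear.Build _ _ _ _ f fl).
  rewrite -[f v]/(F v) {1}(coord_basis he (memvf v)) linear_sum.
  by apply: eq_bigr => i _; rewrite linearZ.
rewrite [RHS](ex _ a (l1 b c d)); apply: eq_bigr => i _.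
rewrite (ex _ b (l2 _ c d)) big_distrr; apply: eq_bigr => j _ /=.
rewrite (ex _ c (l3 _ _ d)) 2!big_distrr; apply: eq_bigr => k _ /=.
rewrite (ex _ d (l4 _ _ _)) 3!big_distrr; apply: eq_bigr => l _ /=.
by rewrite /pure4 /dual_basis !lfunE /= !mulrA.
Qed.

Definition in_dual_cone e M : Prop :=
  in_W M /\ (forall S, in_cone S -> 0 <= pairing e M S).

Definition mat e g : 'M[R]_3 := \matrix_(i, j) coord e i (g e`_j).

(* g is in SO(3), for the identification of V with R^3 by e, and fixes the third
   basis vector; this is the subgroup SO(2). *)
Definition rotation_e3 e g : Prop :=
  [/\ (mat e g)^T *m mat e g = 1%:M, \det (mat e g) = 1 & g e`_2 = e`_2].

(* The action of g on V^{(x)4}: pure4 a b c d is sent to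
   pure4 (g a) (g b) (g c) (g d). *)
Definition act g M : form4 dual :=
  fun x y z t => M (x \o g)%VF (y \o g)%VF (z \o g)%VF (t \o g)%VF.

Definition SO2_invariant e M : Prop :=
  forall g, rotation_e3 e g -> forall x y z t, act g M x y z t = M x y z t.

Definition elastic_bounds M : Prop := forall x y : dual, 0 <= M x y x y.

End Dual.

(* Main.v *)
Require Import Defs.
From HB Require Import structures.
From mathcomp Require Import all_boot all_order all_algebra.
From mathcomp Require Import reals ring lra.

Set Implicit Arguments.
Unset Strict Implicit.
Unset Printing Implicit Defensive.
Import Order.TTheory GRing.Theory Num.Theory.
Local Open Scope ring_scope.

(* Up to its symmetries, M is determined by f(x, y) = M(x (x) y, x (x) y).
   Splitting x = (z, x3) and y = (w, y3) along the axis and putting t = x3 y3,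
   s = <z, w>, r = z x w, invariance under the rotations by 180 and 90 degrees
   and by the angle of the (3, 4, 5) triangle already forces
     f = a t^2 + b (|z|^2 y3^2 + x3^2 |w|^2) + d t s + P s^2 + p r^2.
   Hence M(S) = a X + b W + d Y + P Z + p K, where X, Y, Z are the entries of the
   Gram matrix under S of E33 and E11 + E22, K = S(E12 - E21, E12 - E21) and
   W, Y satisfy 2 |Y| <= W because S is nonnegative on E13 +- E31 and E23 +- E32.
   The elastic bounds at vectors (k, 0, 1), (k, 0, +-1) read
   a + (2 b +- d) k^2 + P k^4 >= 0, and taking k^2 = |Y| / X gives M(S) >= 0.
   Conversely, S = (x (x) y)^2 + (y (x) x)^2 lies in the cone and
   M(S) = 2 f(x, y). *)

(** * Symmetries of W and the components of an axially symmetric form *)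

Section Forms.
Variables (R : realType) (U : lmodType R).
Implicit Types (T : form4 U) (x y z : U).

Lemma multilinear4_lincomb p q S T : multilinear4 S -> multilinear4 T ->
  multilinear4 (fun a b c d => p * S a b c d + q * T a b c d).
Proof.
move=> [s1 s2 s3 s4] [t1 t2 t3 t4]; split=> u v w k x y /=.
- by rewrite (s1 u v w k x y) (t1 u v w k x y) /=; ring.
- by rewrite (s2 u v w k x y) (t2 u v w k x y) /=; ring.
- by rewrite (s3 u v w k x y) (t3 u v w k x y) /=; ring.
- by rewrite (s4 u v w k x y) (t4 u v w k x y) /=; ring.
Qed.

Lemma multilinear4_swap T : multilinear4 T ->
  multilinear4 (fun a b c d => T b a c d).
Proof.
move=> [t1 t2 t3 t4]; split=> u v w.
- exact: t2.
- exact: t1.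
- exact: t3.
- exact: t4.
Qed.

Lemma eq_multilinear4 S T : (forall a b c d, S a b c d = T a b c d) ->
  multilinear4 S -> multilinear4 T.
Proof.
move=> E [s1 s2 s3 s4]; split=> u v w k x y; rewrite -!E.
- exact: s1.
- exact: s2.
- exact: s3.
- exact: s4.
Qed.

(** Pair symmetry conjugates [tau], the exchange of slots 2 and 4, into the exchange of slots 1 and
    3. In the last identity the two signs of the alternating part cancel. *)
Lemma in_W_sym T : in_W T ->
  [/\ multilinear4 T, forall a b c d, T c b a d = T a b c d,
      forall a b c d, T a d c b = T a b c d
    & forall a b c d, T b a d c = T a b c d].
Proof.
move=> [[T1 [T2 [[m1 s1 s1' p1] [m2 s2 s2' p2] E]]] t].
have pair a b c d : T c d a b = T a b c d by rewrite !E p1 p2.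
split.
- apply: eq_multilinear4 (multilinear4_lincomb 1 1 m1 m2) => a b c d.
  by rewrite E !mul1r.
- by move=> a b c d; rewrite -pair -[RHS]t.
- by move=> a b c d; rewrite -[RHS]t.
- by move=> a b c d; rewrite !E s1 s1' s2 s2' opprK.
Qed.

(** The summands are the symmetric and antisymmetric parts of [T] in its first two slots. The
    simultaneous exchange in both pairs carries these symmetries over to the last two slots. *)
Lemma in_W_of_sym T : multilinear4 T -> (forall a b c d, T c b a d = T a b c d) ->
  (forall a b c d, T a d c b = T a b c d) ->
  (forall a b c d, T b a d c = T a b c d) -> in_W T.
Proof.
move=> mT s13 s24 sp; split=> //.
have pair a b c d : T c d a b = T a b c d by rewrite s13 s24.
have sp' a b c d : T a b d c = T b a c d by rewrite -sp.
exists (fun a b c d => 2^-1 * T a b c d + 2^-1 * T b a c d),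
  (fun a b c d => 2^-1 * T a b c d + - 2^-1 * T b a c d); split.
- split=> [|a b c d|a b c d|a b c d]; last by rewrite !(pair a b) (sp' a b c d).
  + exact: multilinear4_lincomb (multilinear4_swap mT).
  + exact: addrC.
  + by rewrite (sp' a b c d) (sp' b a c d) addrC.
- split=> [|a b c d|a b c d|a b c d]; last by rewrite !(pair a b) (sp' a b c d).
  + exact: multilinear4_lincomb (multilinear4_swap mT).
  + by ring.
  + by rewrite (sp' a b c d) (sp' b a c d); ring.
- by move=> a b c d; field.
Qed.

Lemma multilinear4_comb T : multilinear4 T ->
  [/\ forall p q x y b c d,
        T (p *: x + q *: y) b c d = p * T x b c d + q * T y b c d,
      forall p q x y a c d,
        T a (p *: x + q *: y) c d = p * T a x c d + q * T a y c d,
      forall p q x y a b d,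
        T a b (p *: x + q *: y) d = p * T a b x d + q * T a b y d
    & forall p q x y a b c,
        T a b c (p *: x + q *: y) = p * T a b c x + q * T a b c y].
Proof.
move=> [l1 l2 l3 l4].
have comb (f : U -> R) p q x y : scalar f ->
    f (p *: x + q *: y) = p * f x + q * f y.
  move=> fl; pose F : {scalar U} :=
    HB.pack f (GRing.isLinear.Build _ _ _ _ f fl).
  by rewrite -[LHS]/(F _) linearD !linearZ.
split=> p q x y u v w.
- exact: (comb _ _ _ _ _ (l1 _ _ _)).
- exact: (comb _ _ _ _ _ (l2 _ _ _)).
- exact: (comb _ _ _ _ _ (l3 _ _ _)).
- exact: (comb _ _ _ _ _ (l4 _ _ _)).
Qed.

(* Orders the arguments lexicographically, first inside the slot pairs (1, 3)
   and (2, 4), then between the two pairs. *)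
Definition canonical_order T (s13 : forall a b c d, T c b a d = T a b c d)
    (s24 : forall a b c d, T a d c b = T a b c d)
    (sp : forall a b c d, T b a d c = T a b c d) x y z :=
  ((fun b d => s13 x b y d, fun b d => s13 x b z d, fun b d => s13 y b z d),
   (fun a c => s24 a x c y, fun a c => s24 a x c z, fun a c => s24 a y c z),
   (sp x x x y, sp x x x z, sp x y x y, sp x y x z, sp x z x z),
   (sp x x y z, sp x y y y, sp x y y z, sp x z y z),
   (sp x y z y, sp x y z z, sp x z z z),
   (sp y y y z, sp y z y z), sp y z z z).

(** The signs are those of a transposed rotation, since a rotation acts on the dual basis by
    precomposition. *)
Definition axial_symmetry T x y z := forall c s, c ^+ 2 + s ^+ 2 = 1 ->
  exists g : U -> U, [/\ g x = c *: x + (- s) *: y, g y = s *: x + c *: y,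
    g z = z & forall a b c d, T (g a) (g b) (g c) (g d) = T a b c d].

Lemma axial_components T x y z : in_W T -> axial_symmetry T x y z ->
  [/\ [/\ T x x x z = 0, T x y x z = 0, T x x y z = 0 & T x y y z = 0],
      [/\ T x y z y = 0, T y y y z = 0, T x z z z = 0 & T y z z z = 0],
      [/\ T x x x y = 0, T x y y y = 0, T x z y z = 0 & T x y z z = 0] &
      [/\ T y y y y = T x x x x, T x x y y = (T x x x x - T x y x y) / 2,
          T y z y z = T x z x z & T y y z z = T x x z z]].
Proof.
move=> /in_W_sym[mT s13 s24 sp] symT.
have [c1 c2 c3 c4] := multilinear4_comb mT.
have N := canonical_order s13 s24 sp x y z.
have h0 : (-1) ^+ 2 + 0 ^+ 2 = 1 :> R by ring.
have h1 : 0 ^+ 2 + 1 ^+ 2 = 1 :> R by ring.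
(* A rational angle off the quarter turns keeps the component equations linear with rational
   coefficients. *)
have h2 : (3 / 5) ^+ 2 + (4 / 5) ^+ 2 = 1 :> R by field.
have [g [gx gy gz gT]] := symT _ _ h0.
have [k [kx ky kz kT]] := symT _ _ h1.
have [l [lx ly lz lT]] := symT _ _ h2.
(* The components in the plane of [x] and [y] are coupled: these four equations form one linear
   system for them, solved below. Every other component is settled by a single half or quarter
   turn. *)
have [[[e1 e2] e3] e4] := (kT x x x y, lT x x x y, lT x x x x, kT x x x x).
rewrite !(kx, ky, lx, ly, c1, c2, c3, c4, N) in e1 e2 e3 e4.
split; split.
- by have := gT x x x z; rewrite !(gx, gy, gz, c1, c2, c3, c4, N); lra.
- by have := gT x y x z; rewrite !(gx, gy, gz, c1, c2, c3, c4, N); lra.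
- by have := gT x x y z; rewrite !(gx, gy, gz, c1, c2, c3, c4, N); lra.
- by have := gT x y y z; rewrite !(gx, gy, gz, c1, c2, c3, c4, N); lra.
- by have := gT x y z y; rewrite !(gx, gy, gz, c1, c2, c3, c4, N); lra.
- by have := gT y y y z; rewrite !(gx, gy, gz, c1, c2, c3, c4, N); lra.
- by have := gT x z z z; rewrite !(gx, gy, gz, c1, c2, c3, c4, N); lra.
- by have := gT y z z z; rewrite !(gx, gy, gz, c1, c2, c3, c4, N); lra.
- by lra.
- by lra.
- by have := kT x z y z; rewrite !(kx, ky, kz, c1, c2, c3, c4, N); lra.
- by have := kT x y z z; rewrite !(kx, ky, kz, c1, c2, c3, c4, N); lra.
- by lra.
- by lra.
- by have := kT x z x z; rewrite !(kx, ky, kz, c1, c2, c3, c4, N); lra.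
- by have := kT x x z z; rewrite !(kx, ky, kz, c1, c2, c3, c4, N); lra.
Qed.

(** The weights are absorbed into the first factors of the pure tensors. *)
Lemma psd_lincomb S n (c : 'I_n -> R) (a b : 'I_n -> U) :
  multilinear4 S -> psd S ->
  0 <= \sum_(k < n) \sum_(l < n) c k * c l * S (a k) (b k) (a l) (b l).
Proof.
move=> /multilinear4_comb[s1 _ s3 _] /(_ n (fun k => c k *: a k) b).
congr (_ <= _); apply: eq_bigr => k _; apply: eq_bigr => l _.
have sc q (u : U) : q *: u = q *: u + 0 *: u by rewrite scale0r addr0.
by rewrite (sc _ (a k)) s1 (sc _ (a l)) s3; ring.
Qed.

End Forms.

(** * The scalar inequality and its application to the contraction *)

(* If X > 0 the inequality is X times the hypothesis on a, b, d, P at k with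
   k ^+ 2 = |Y| / X, because Y ^+ 2 <= X * Z. *)
Lemma axial_pairing_ge0 (R : realType) (a b d P X Y Z W : R) :
  0 <= b -> 0 <= P ->
  (forall k, 0 <= a + (2 * b + d) * k ^+ 2 + P * k ^+ 4) ->
  (forall k, 0 <= a + (2 * b - d) * k ^+ 2 + P * k ^+ 4) ->
  (forall u v, 0 <= u ^+ 2 * X + 2 * (u * v) * Y + v ^+ 2 * Z) ->
  2 * Y <= W -> - (2 * Y) <= W ->
  0 <= a * X + b * W + d * Y + P * Z.
Proof.
move=> b0 P0 hp hm psdS W1 W2.
have X0 : 0 <= X by have := psdS 1 0; lra.
have Z0 : 0 <= Z by have := psdS 0 1; lra.
have YXZ : Y ^+ 2 <= X * Z.
  have [X00|Xn0] := eqVneq X 0.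
    (* With [X = 0] the form takes here the value [- Y ^+ 2 * (Z + 2)], which forces [Y = 0]. *)
    have := mulr_ge0 (sqr_ge0 Y) Z0; have := psdS (Z + 1) (- Y).
    by rewrite X00; lra.
  have Xp : 0 < X by rewrite lt_def Xn0.
  by rewrite -subr_ge0 -(pmulr_rge0 _ Xp); have := psdS Y (- X); lra.
have [X00|Xn0] := eqVneq X 0.
  have Y00 : Y = 0 by apply/eqP; rewrite -sqrf_eq0; nra.
  by rewrite X00 Y00 !mulr0; nra.
have Xp : 0 < X by rewrite lt_def Xn0.
pose k := Num.sqrt (`|Y| / X).
have kX : k ^+ 2 * X = `|Y|.
  by rewrite sqr_sqrtr ?divr_ge0 // divfK.
have k4 : P * k ^+ 4 * X <= P * Z.
  rewrite -mulrA ler_wpM2l // -(ler_pM2r Xp).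
  suff -> : k ^+ 4 * X * X = Y ^+ 2 by rewrite [Z * X]mulrC.
  by rewrite -(real_normK (num_real Y)) -kX; ring.
have bW : b * (2 * `|Y|) <= b * W.
  by apply: ler_wpM2l => //; case: (ger0P Y); lra.
have := mulr_ge0 (hp k) X0; have := mulr_ge0 (hm k) X0.
rewrite !mulrDl -![_ * k ^+ 2 * X]mulrA kX.
case: (ger0P Y) bW => _ bW; lra.
Qed.

(** With the dual basis for [f] and the basis for [h], the sum is the pairing of [T] with [S]. *)
Lemma contraction_ge0 (R : realType) (U U' : lmodType R) (T : form4 U)
    (S : form4 U') (f : 'I_3 -> U) (h : 'I_3 -> U') :
  in_W T -> axial_symmetry T (f 0) (f 1) (f 2) ->
  (forall x y, 0 <= T x y x y) -> in_cone S ->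
  0 <= \sum_i \sum_j \sum_k \sum_l
    T (f i) (f j) (f k) (f l) * S (h i) (h j) (h k) (h l).
Proof.
have sum3 (F : 'I_3 -> R) : \sum_i F i = F 0 + F 1 + F 2.
  rewrite !big_ord_recr big_ord0 /= add0r.
  by congr (F _ + F _ + F _); exact: val_inj.
rewrite !sum3.
move: (f 0) (f 1) (f 2) (h 0) (h 1) (h 2) => x y z x' y' z' {f h sum3}.
move=> wT symT el [wS psdS].
have [[t1 t2 t3 t4] [t5 t6 t7 t8] [t9 t10 t11 t12] [t13 t14 t15 t16]] :=
  axial_components wT symT.
pose vals := ((t1, t2, t3, t4), (t5, t6, t7, t8),
  (t9, t10, t11, t12), (t13, t14, t15, t16)).
have [mT sT13 sT24 spT] := in_W_sym wT.
have [mS sS13 sS24 spS] := in_W_sym wS.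
have [c1 c2 c3 c4] := multilinear4_comb mT.
have NT := canonical_order sT13 sT24 spT x y z.
have NS := canonical_order sS13 sS24 spS x' y' z'.
have psd3 p q r a1 a2 a3 b1 b2 b3 := psd_lincomb
  (fun i : 'I_3 => [:: p; q; r]`_i)
  (fun i => [:: a1; a2; a3]`_i) (fun i => [:: b1; b2; b3]`_i) mS psdS.
rewrite !(NT, NS) !vals.
set A := T z z z z; set B := T x z x z; set D := T x x z z; set P := T x x x x.
set Q := T x y x y.
have [B0 P0 Q0] : [/\ 0 <= B, 0 <= P & 0 <= Q] by split; exact: el.
(* The factor 4 counts the placements of one [x] and one [z] in each of the slot pairs (1, 3) and
   (2, 4). *)
have hp k : 0 <= A + (2 * B + 4 * D) * k ^+ 2 + P * k ^+ 4.
  have := el (k *: x + 1 *: z) (k *: x + 1 *: z).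
  by rewrite !(c1, c2, c3, c4) !NT !vals -/A -/B -/D -/P; lra.
have hm k : 0 <= A + (2 * B - 4 * D) * k ^+ 2 + P * k ^+ 4.
  have := el (k *: x + 1 *: z) (k *: x + (- 1) *: z).
  by rewrite !(c1, c2, c3, c4) !NT !vals -/A -/B -/D -/P; lra.
have axialS u v : 0 <= u ^+ 2 * S z' z' z' z' +
    2 * (u * v) * (S x' x' z' z' + S y' y' z' z') +
    v ^+ 2 * (S x' x' x' x' + S y' y' y' y' + 2 * S x' x' y' y').
  have := psd3 u v v z' x' y' z' x' y'.
  by rewrite !big_ord_recl !big_ord0 /= !NS; lra.
have twist : 0 <= S x' y' x' y' - S x' x' y' y'.
  have := psd3 1 (-1) 0 x' y' 0 y' x' 0.
  by rewrite !big_ord_recl !big_ord0 /= !NS; lra.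
have shearS c : c ^+ 2 = 1 ->
    - (2 * (c * (S x' x' z' z' + S y' y' z' z'))) <=
    2 * S x' z' x' z' + 2 * S y' z' y' z'.
  move=> cc.
  have := psd3 1 c 0 x' z' 0 z' x' 0.
  have := psd3 1 c 0 y' z' 0 z' y' 0.
  by rewrite !big_ord_recl !big_ord0 /= !NS -!expr2 cc; lra.
have sh1 := shearS 1 (expr1n _ _); have sh2 := shearS (-1) (sqrr_sign _ 1).
have W1 : 2 * (S x' x' z' z' + S y' y' z' z') <=
  2 * S x' z' x' z' + 2 * S y' z' y' z' by lra.
have W2 : - (2 * (S x' x' z' z' + S y' y' z' z')) <=
  2 * S x' z' x' z' + 2 * S y' z' y' z' by lra.
(* After substitution of the components, the contraction is the quantity bounded here plus twice [Q]
   times the expression in [twist]. *)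
have := axial_pairing_ge0 B0 P0 hp hm axialS W1 W2.
have := mulr_ge0 Q0 twist; lra.
Qed.

(** * Dual basis, rank-one forms and rotations *)

Section Dual.
Variables (R : realType) (V : vectType R) (e : 3.-tuple V).
Hypothesis he : basis_of {:V} e.
Implicit Types (M : form4 (dual V)) (x y z t : dual V).

Lemma coord_basis_delta (i j : 'I_3) : coord e i e`_j = (i == j)%:R.
Proof. by rewrite coord_free ?(basis_free he) // eq_sym. Qed.

Lemma dual_coordE x : x = \sum_(i < 3) x e`_i *: dual_basis e i.
Proof.
apply/lfunP => v; rewrite {1}(coord_basis he (memvf v)) linear_sum sum_lfunE.
by apply: eq_bigr => i _; rewrite linearZ scale_lfunE lfunE; apply: mulrC.
Qed.

Lemma dual_scalarE (f : dual V -> R) x : scalar f ->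
  f x = \sum_(i < 3) x e`_i * f (dual_basis e i).
Proof.
move=> fl; pose F : {scalar dual V} :=
  HB.pack f (GRing.isLinear.Build _ _ _ _ f fl).
rewrite {1}(dual_coordE x) -[LHS]/(F _) linear_sum.
by apply: eq_bigr => i _; rewrite linearZ.
Qed.

Lemma pairing_rank1 M x y z t : multilinear4 M ->
  pairing e M (fun a b c d => x a * y b * z c * t d) = M x y z t.
Proof.
move=> [l1 l2 l3 l4].
rewrite [RHS](dual_scalarE _ (l1 _ _ _)); apply: eq_bigr => i _.
rewrite (dual_scalarE _ (l2 _ _ _)) big_distrr; apply: eq_bigr => j _ /=.
rewrite (dual_scalarE _ (l3 _ _ _)) 2!big_distrr; apply: eq_bigr => k _ /=.
rewrite (dual_scalarE _ (l4 _ _ _)) 3!big_distrr; apply: eq_bigr => l _ /=.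
by ring.
Qed.

Lemma pairingD M (S T : form4 V) :
  pairing e M (fun a b c d : V => S a b c d + T a b c d) =
    pairing e M S + pairing e M T.
Proof.
rewrite /pairing; do 4! [rewrite -big_split; apply: eq_bigr => ? _ /=].
exact: mulrDr.
Qed.

(** Evaluated on a tensor, the form is a sum of two squares. The second term supplies the invariance
    under simultaneous exchange in both slot pairs. *)
Lemma rank1_in_cone x y :
  in_cone (fun a b c d => x a * y b * x c * y d + y a * x b * y c * x d).
Proof.
split.
  apply: in_W_of_sym => [|a b c d|a b c d|a b c d]; try by ring.
  by split=> a b c k u v /=; rewrite !linearP /= /GRing.scale /=; ring.
move=> n a b.
have sq (u v : dual V) :
    \sum_(k < n) \sum_(l < n) u (a k) * v (b k) * u (a l) * v (b l) =
      (\sum_(k < n) u (a k) * v (b k)) ^+ 2.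
  rewrite expr2 mulr_suml; apply: eq_bigr => k _; rewrite mulr_sumr.
  by apply: eq_bigr => l _; rewrite !mulrA.
under eq_bigr do rewrite big_split.
by rewrite big_split /= !sq addr_ge0 ?sqr_ge0.
Qed.

Lemma elastic_of_dual_cone M : in_dual_cone e M -> elastic_bounds M.
Proof.
move=> [wM pM] x y; have [mM _ _ sp] := in_W_sym wM.
have := pM _ (rank1_in_cone x y).
rewrite (pairingD M (fun a b c d => x a * y b * x c * y d)) !pairing_rank1 //.
rewrite (sp x y x y); lra.
Qed.

Lemma exists_rotation c s : c ^+ 2 + s ^+ 2 = 1 -> exists g : 'End(V),
  [/\ rotation_e3 e g, g e`_0 = c *: e`_0 + s *: e`_1
     & g e`_1 = - s *: e`_0 + c *: e`_1].
Proof.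
move=> cs.
pose f (i : 'I_3) :=
  [:: c *: e`_0 + s *: e`_1; - s *: e`_0 + c *: e`_1; e`_2]`_i.
have gl : linear (fun v => \sum_(i < 3) coord e i v *: f i).
  move=> k u v; rewrite scaler_sumr -big_split; apply: eq_bigr => i _ /=.
  by rewrite linearP scalerDl scalerA.
pose g : {linear V -> V} :=
  HB.pack (fun v => \sum_(i < 3) coord e i v *: f i)
    (GRing.isLinear.Build _ _ _ _ _ gl).
have gE (i : 'I_3) : linfun g e`_i = f i.
  rewrite lfunE /= (bigD1 i) //= big1 => [|j /negPf ji].
    by rewrite coord_basis_delta eqxx scale1r addr0.
  by rewrite coord_basis_delta ji scale0r.
exists (linfun g); split; [|exact: (gE 0)|exact: (gE 1)].
have matE : mat e (linfun g) = \matrix_(i < 3, j < 3)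
    nth 0 (nth [::] [:: [:: c; - s; 0]; [:: s; c; 0]; [:: 0; 0; 1]] i) j.
  apply/matrixP => i j.
  have d0 := coord_basis_delta i 0; have d1 := coord_basis_delta i 1.
  have d2 := coord_basis_delta i 2.
  rewrite !mxE gE /f.
  case: j => [[|[|[|//]]] jP] /=; rewrite ?linearD ?linearZ /= ?d0 ?d1 ?d2;
    case: i {d0 d1 d2} => [[|[|[|//]]] iP]; rewrite /= /GRing.scale /=; ring.
rewrite /rotation_e3 matE; split; last exact: (gE 2).
  apply/matrixP => i j; rewrite !mxE !big_ord_recr big_ord0 /= !mxE.
  by case: i j => [[|[|[|//]]] iP] [[|[|[|//]]] jP] /=; move: cs; lra.
rewrite (expand_det_row _ 0) !big_ord_recr big_ord0 /= /cofactor.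
rewrite !(expand_det_row _ 0) !big_ord_recr !big_ord0 /= /cofactor.
rewrite !det_mx11 !mxE /=.
move: cs; lra.
Qed.

(** The map required is precomposition with the rotation, as in [act], so invariance of [M] is the
    last clause and the others are checked on the basis. *)
Lemma axial_symmetry_dual M : SO2_invariant e M ->
  axial_symmetry M (dual_basis e 0) (dual_basis e 1) (dual_basis e 2).
Proof.
move=> inv c s /exists_rotation[g [rg g0 g1]]; exists (fun x => (x \o g)%VF).
have g2 : g e`_2 = e`_2 by case: rg.
have ext (x y : dual V) : (forall i : 'I_3, x e`_i = y e`_i) -> x = y.
  move=> xy; rewrite (dual_coordE x) (dual_coordE y).
  by under eq_bigr do rewrite xy.
have db (i j : 'I_3) : dual_basis e i e`_j = (i == j)%:R.
  by rewrite lfunE /= coord_basis_delta.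
have d0 i := db i 0; have d1 i := db i 1.
have d2 i : dual_basis e i e`_2 = (i == 2)%:R := db i 2.
have ev p q (x y : dual V) v : (p *: x + q *: y) v = p * x v + q * y v.
  by rewrite lfunE /= !scale_lfunE.
split; last by move=> x y z t; exact: (inv g rg x y z t).
- apply: ext => -[[|[|[|//]]] iP]; rewrite comp_lfunE /= ?(g0, g1, g2) ev
    ?linearD ?linearZ /= ?(d0, d1, d2) /GRing.scale /=; ring.
- apply: ext => -[[|[|[|//]]] iP]; rewrite comp_lfunE /= ?(g0, g1, g2) ev
    ?linearD ?linearZ /= ?(d0, d1, d2) /GRing.scale /=; ring.
- apply: ext => -[[|[|[|//]]] iP]; rewrite comp_lfunE /= ?(g0, g1, g2)
    ?linearD ?linearZ /= ?(d0, d1, d2) /GRing.scale /=; ring.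
Qed.

End Dual.

Theorem theorem5p9 (R : realType) (V : vectType R) (hV : \dim {:V} = 3%N)
  (e : 3.-tuple V) (he : basis_of {:V} e)
  (M : form4 (dual V)) (hM : in_W M) (hinv : SO2_invariant e M) :
  in_dual_cone e M <-> elastic_bounds M.
Proof.
split=> [|el]; first exact: elastic_of_dual_cone.
split=> // S coneS.
exact: (contraction_ge0 (fun i : 'I_3 => e`_i) hM
  (axial_symmetry_dual he hinv) el coneS).
Qed.
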